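(* Let $k$ be a positive integer and let $G$ be a graph of order $n$ with minimum degree $\delta \ge 2k+2$ and maximum degree $\Delta$. Let $a \ge 0$ and $b \neq 0$ be real numbers. Then $G$ has property $P(k, \delta)$ if one of the following conditions holds: (i) $\lambda_2(G, a) < (a+1)\delta - \frac{2\left(k+\frac{\delta-1}{\delta}\right)}{\delta+1}$; (ii) $b > 0$ and $\lambda_2(G, a, b) < (a+b)\delta - \frac{2b\left(k+\frac{\delta-1}{\delta}\right)}{\delta+1}$; (iii) $b < 0$ and $\lambda_{n-1}(G, a, b) > a\Delta + b\delta - \frac{2b\left(k+\frac{\delta-1}{\delta}\right)}{\delta+1}$.
   Context: All graphs are finite, undirected and simple. For a graph $G$ of order $n$, let $A(G)$ be its adjacency matrix and $D(G)$ the diagonal matrix of vertex degrees. For real $a,b$, $\lambda_i(G,a)$ and $\lambda_i(G,a,b)$ denote the $i$-th largest eigenvalue (counted with multiplicity) of the matrices $aD(G)+A(G)$ and $aD(G)+bA(G)$, respectively. For positive integers $k,d$, a graph $G$ of order $n$ has property $P(k,d)$ if: (a) $G$ contains $k$ pairwise edge-disjoint spanning trees; (b) apart from these $k$ edge-disjoint spanning trees (i.e. edge-disjoint from them), there exists another forest $F$ in $G$ with number of edges $|E(F)|>\frac{d-1}{d}(n-1)$; and (c) if $F$ is not a spanning tree of $G$, then $F$ has a component with at least $d$ edges. *)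

(* Defs.v *)
From mathcomp Require Import all_boot all_order all_algebra.
From mathcomp Require Import reals polyrcf.

Set Implicit Arguments.
Unset Strict Implicit.
Unset Printing Implicit Defensive.

Import Order.TTheory GRing.Theory Num.Theory.
Local Open Scope ring_scope.

Record sgraph (V : finType) := SGraph {
  adj :> rel V;
  adj_sym : symmetric adj;
  adj_irr : irreflexive adj }.

Section Graphs.
Variables (V : finType) (G : sgraph V).
Implicit Types (F : {set {set V}}).

Definition edges : {set {set V}} :=
  [set [set p.1; p.2] | p : V * V & adj G p.1 p.2].

Definition degree (v : V) : nat := #|[set w | adj G v w]|.

(* Degrees are smaller than #|V|, so the default value #|V| is never attained
   when V is nonempty. *)
Definition min_degree : nat := \big[minn/#|V|]_(v : V) degree v.

Definition max_degree : nat := \max_(v : V) degree v.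

(* A set F of edges stands for the spanning subgraph (V, F). *)
Definition edge_rel F : rel V := [rel x y | (x != y) && ([set x; y] \in F)].

(* In ucycle, the closed walk x, y, x given by a single edge {x, y} has
   size 2, so the cycles of a graph are those of size at least 3. *)
Definition acyclic F : Prop :=
  forall c : seq V, ucycle (edge_rel F) c -> (size c <= 2)%N.

Definition is_forest F : Prop := F \subset edges /\ acyclic F.

Definition is_spanning_tree F : Prop :=
  is_forest F /\ forall x y : V, connect (edge_rel F) x y.

Definition component F (x : V) : {set V} := [set y | connect (edge_rel F) x y].

Definition component_edges F (x : V) : {set {set V}} :=
  [set f in F | f \subset component F x].

Definition property_P (k d : nat) : Prop :=
  exists (T : 'I_k -> {set {set V}}) (F : {set {set V}}),
    [/\ (forall i, is_spanning_tree (T i)) /\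
          (forall i j, i != j -> [disjoint T i & T j]),
        is_forest F /\ (forall i, [disjoint F & T i]),
        (d%:R - 1) / d%:R * (#|V|%:R - 1) < #|F|%:R :> rat
      & ~ is_spanning_tree F -> exists x : V, (d <= #|component_edges F x|)%N].

End Graphs.

Section Spectrum.
Variables (R : realType) (n : nat).
Implicit Types (M : 'M[R]_n) (G : sgraph 'I_n).

(* The real roots of the characteristic polynomial in nonincreasing order, each
   repeated according to its multiplicity. *)
Definition eigenvalues M : seq R :=
  flatten [seq nseq (mup x (char_poly M)) x | x <- rev (rootsR (char_poly M))].

Lemma count_eigenvalues M x : count_mem x (eigenvalues M) = mup x (char_poly M).
Proof.
have p0 : char_poly M != 0 by rewrite monic_neq0 ?char_poly_monic.
set p := char_poly M in p0 *.
have U : uniq (rev (rootsR p)).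
  by rewrite rev_uniq (sorted_uniq lt_trans ltxx) ?sorted_roots.
have E : (x \in rev (rootsR p)) = root p x.
  by rewrite mem_rev -(roots_on_rootsR p0) in_itv.
have -> : mup x p = if x \in rev (rootsR p) then mup x p else 0%N.
  by rewrite E; case: ifPn => // /mupNroot.
rewrite /eigenvalues -/p; elim: (rev _) U => [|y s IHs] //= /andP[ys U].
rewrite count_cat count_nseq /= IHs // in_cons eq_sym.
case: eqVneq => [->|_] /=; last by rewrite mul0n.
by rewrite (negPf ys) mul1n addn0.
Qed.

Lemma sorted_eigenvalues M : sorted >=%R (eigenvalues M).
Proof.
rewrite (sorted_pairwise (rev_trans le_trans)).
have : pairwise >%R (rev (rootsR (char_poly M))).
  by rewrite -(sorted_pairwise (rev_trans lt_trans)) rev_sorted sorted_roots.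
rewrite /eigenvalues; elim: (rev _) => [|x s IHs] //= /andP[/allP xs ps].
rewrite pairwise_cat IHs // andbT; apply/andP; split; last first.
  elim: (mup _ _) => //= m ->; rewrite andbT.
  by apply/allP=> y /nseqP[-> _]; apply: lexx.
apply/allrelP => y z /nseqP[-> _] /flatten_mapP[w ws /nseqP[-> _]].
exact/ltW/xs.
Qed.

Lemma eigenvalues_unique M (s : seq R) :
    sorted >=%R s -> char_poly M = \prod_(x <- s) ('X - x%:P) ->
  eigenvalues M = s.
Proof.
move=> ss Ms; apply: (sorted_eq (rev_trans le_trans)) => //.
- by move=> x y /=; rewrite andbC => /le_anti.
- exact: sorted_eigenvalues.
by apply/allP=> x _ /=; rewrite count_eigenvalues Ms mu_prod_XsubC.
Qed.

(* The i-th largest eigenvalue, counting from i = 1. *)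
Definition lambda (i : nat) M : R := (eigenvalues M)`_i.-1.

Definition adjacency_mx G : 'M[R]_n := \matrix_(i, j) (adj G i j)%:R.

Definition degree_mx G : 'M[R]_n := diag_mx (\row_i (degree G i)%:R).

Definition lambda_a (i : nat) G (a : R) : R :=
  lambda i (a *: degree_mx G + adjacency_mx G).

Definition lambda_ab (i : nat) G (a b : R) : R :=
  lambda i (a *: degree_mx G + b *: adjacency_mx G).

End Spectrum.

(* Main.v *)
Require Import Defs.
From mathcomp Require Import all_boot all_order all_algebra.
From mathcomp Require Import reals.
From mathcomp Require Import sesquilinear spectral complex zify ring lra.

Set Implicit Arguments.
Unset Strict Implicit.
Unset Printing Implicit Defensive.

Import Order.TTheory GRing.Theory Num.Theory.

(** Write [tau = k + (delta - 1) / delta]. The proof joins a spectral argument that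
    forces many edges between the parts of any partition of the vertices, and a
    packing theorem of Nash-Williams and Tutte type that turns edges into trees.

    Spectral part. For disjoint sets [S] and [T] of more than [delta] vertices each,
    the Courant-Fischer principle on the plane spanned by their indicator vectors
    shows that if [T] has at least as many leaving edges as [S], then the leaving
    edges of [T] and the edges between [S] and [T] number at least [2 * tau] together
    ([spectral_separation]). A nonempty set of at most [delta] vertices has at least
    [delta >= 2 * k + 2] leaving edges, just because of the degrees ([small_cut]).
    In a partition into [t] parts, comparing every part with the one that has the
    fewest leaving edges gives at least [(k + 1) * (t - 1) - q / delta] edges between
    parts, where [q] counts large parts and so [q * (delta + 1) < n]
    ([separated_components]).

    Packing part. In a family of edge-disjoint forests that is maximal for the sizes of
    its members, let [C] be the set of the edges that can be freed by successive
    exchanges along fundamental cycles. Every forest of the family spans every component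
    of [C], and all edges outside [C] are used ([maximal_packing_tight], for an
    arbitrary matroid). So if [C] has [t] components, each of the forests has [n - t] of
    its edges in [C], and the total size of the family is known
    ([forest_packing_tight]).

    Applied to [k] forests, the two parts together show that all of them are spanning
    trees. The [k] trees are then enlarged to a maximal family of [k] trees and one more
    forest [F]; maximality is taken for the pointwise order on sizes, so the trees stay
    spanning. The count now says that [F] has at most [1 + q / delta] components. This
    is less than [n / delta]: it yields the number of edges of [F], and a component
    with more than [delta] vertices as soon as [F] is not connected
    ([separation_property_P]). *)

(** * Packing independent sets of a matroid *)

(** Finite matroids enter through their closure operator: an extensive, monotone
    and idempotent [cl] (the last two are [cl_min]) with the exchange property. *)
Section Matroid.
Variables (T : finType) (cl : {set T} -> {set T}).
Implicit Types (A B : {set T}) (x y : T).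
Hypothesis cl_ext : forall A : {set T}, A \subset cl A.
Hypothesis cl_min : forall A B : {set T}, A \subset cl B -> cl A \subset cl B.
Hypothesis cl_exch : forall (A : {set T}) x y,
  x \in cl (y |: A) -> x \notin cl A -> y \in cl (x |: A).

Definition independent A := [forall x in A, x \notin cl (A :\ x)].

Lemma independentP A :
  reflect (forall x, x \in A -> x \notin cl (A :\ x)) (independent A).
Proof. exact: forall_inP. Qed.

Lemma cl_mono A B : A \subset B -> cl A \subset cl B.
Proof. by move=> AB; apply: cl_min; apply: subset_trans (cl_ext B). Qed.

Lemma independent_sub A B : A \subset B -> independent B -> independent A.
Proof.
move=> AB /independentP iB; apply/independentP => x xA.
apply: contra (iB x (subsetP AB x xA)).
by apply: (subsetP (cl_mono _)); apply: setSD.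
Qed.

Lemma independentU1 A x : independent A -> x \notin cl A -> independent (x |: A).
Proof.
move=> /independentP iA xA; apply/independentP => y; rewrite !inE.
case/predU1P=> [->|yA].
  apply: contra xA; apply: (subsetP (cl_mono _)).
  by apply/subsetP=> z; rewrite !inE; case: eqP.
have yx : y != x by apply: contraNneq xA => <-; apply: (subsetP (cl_ext A)).
apply/negP; rewrite setDUl (setDidPl _); last by rewrite disjoints1 inE eq_sym.
move=> /cl_exch /(_ (iA y yA)); rewrite setD1K // => xA'.
by rewrite xA' in xA.
Qed.

(** In an independent set, the circuit closed by [x] consists of the elements
    whose removal takes [x] out of the closure: a minimal subset of [A] spanning
    [x] contains nothing else, by the exchange property. *)
Lemma cl_circuit A x : independent A -> x \in cl A ->
  x \in cl [set y in A | x \notin cl (A :\ y)].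
Proof.
move=> /independentP iA xA.
have [B /minsetP[xB minB] BA] := @minset_exists _ (fun B => x \in cl B) A xA.
apply: (subsetP (cl_mono _) x xB); apply/subsetP => y yB.
have yA := subsetP BA y yB; rewrite inE yA /=.
have xBy : x \notin cl (B :\ y).
  by apply/negP => /minB/(_ (subsetDl _ _)) E; rewrite -E !inE eqxx in yB.
apply: contra (iA y yA) => xAy.
have: y \in cl (x |: (B :\ y)) by apply: cl_exch xBy; rewrite setD1K.
apply/subsetP/cl_min; rewrite subUset sub1set xAy /=.
exact: subset_trans (setSD _ BA) (cl_ext _).
Qed.

Section Packing.
Variables (I : finType) (E : {set T}).
Implicit Types c : {ffun T -> option I}.

(** A colouring stands for a family of disjoint subsets of [E] indexed by [I]; the
    elements of colour [None] are left uncovered. *)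
Definition colour_class c i : {set T} := [set x in E | c x == Some i].

Definition packing c := [forall i, independent (colour_class c i)].

(** Maximality is for the pointwise order on the sizes of the classes, so that a
    packing can be enlarged without shrinking classes that are already bases. *)
Definition maximal_packing c :=
  packing c /\
  forall c', packing c' ->
    (forall i, #|colour_class c i| <= #|colour_class c' i|)%N ->
    forall i, #|colour_class c' i| = #|colour_class c i|.

Definition exchange c x i y : {ffun T -> option I} :=
  [ffun z => if z == x then Some i else if z == y then None else c z].

Definition exchange_step : rel {ffun T -> option I} := fun c c' =>
  [exists x in E, exists i, exists y in colour_class c i,
    [&& c x == None, x \notin cl (colour_class c i :\ y)
      & c' == exchange c x i y]].

Lemma exchange_stepP c c' :
  reflect (exists x i y, [/\ x \in E, c x = None, y \in colour_class c i,
              x \notin cl (colour_class c i :\ y) & c' = exchange c x i y])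
          (exchange_step c c').
Proof.
apply: (iffP idP).
  case/exists_inP=> x xE /existsP[i /exists_inP[y yc /and3P[/eqP cx xy /eqP ->]]].
  by exists x, i, y; split.
case=> x [i [y [xE cx yc xy ->]]].
apply/exists_inP; exists x => //; apply/existsP; exists i.
by apply/exists_inP; exists y => //; rewrite cx xy !eqxx.
Qed.

Lemma colour_class_exchange c x i y j :
    x \in E -> c x = None -> y \in colour_class c i ->
  colour_class (exchange c x i y) j =
    if j == i then x |: (colour_class c i :\ y) else colour_class c j.
Proof.
move=> xE cx; rewrite inE => /andP[yE /eqP cy].
apply/setP=> z; rewrite inE ffunE.
case: (eqVneq j i) => [->|ji]; rewrite !inE.
  case: (eqVneq z x) => [->|zx] /=; first by rewrite xE eqxx.
  by case: (eqVneq z y) => [_|zy] /=; rewrite ?andbF.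
have ij : (Some i == Some j) = false.
  by rewrite (inj_eq Some_inj) eq_sym (negPf ji).
case: (eqVneq z x) => [->|zx]; first by rewrite cx ij.
by case: (eqVneq z y) => [->|//]; rewrite cy ij.
Qed.

(** An exchange replaces an element of a circuit by the uncovered element that
    closes this circuit, so it keeps classes independent and their sizes. *)
Lemma exchange_step_packing c c' : exchange_step c c' -> packing c ->
  packing c' /\ forall i, #|colour_class c' i| = #|colour_class c i|.
Proof.
case/exchange_stepP=> x [i [y [xE cx yc xy ->]]] /forallP pc.
have xc : x \notin colour_class c i by rewrite inE cx andbF.
split=> [|j].
  apply/forallP=> j; rewrite colour_class_exchange //; case: eqP => // _.
  by apply: independentU1 => //; apply: independent_sub (pc i); apply: subsetDl.
rewrite colour_class_exchange //; case: eqP => // ->.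
by rewrite cardsU1 in_setD1 (negPf xc) andbF add1n [RHS](cardsD1 y) yc.
Qed.

Lemma maximal_packing_step c c' :
  exchange_step c c' -> maximal_packing c -> maximal_packing c'.
Proof.
move=> st [pc maxc]; have [pc' szc'] := exchange_step_packing st pc.
split=> // c'' pc'' le i; rewrite szc'; apply: maxc => // j.
by rewrite -szc'.
Qed.

Lemma maximal_packing_reach c c' :
  connect exchange_step c c' -> maximal_packing c -> maximal_packing c'.
Proof.
case/connectP=> p + ->; elim: p c => //= c1 p IHp c /andP[/maximal_packing_step st].
by move=> /IHp {}IHp /st.
Qed.

(** Otherwise [x] could be added to class [i]. *)
Lemma maximal_packing_cl c x i :
  maximal_packing c -> x \in E -> c x = None -> x \in cl (colour_class c i).
Proof.
move=> [/forallP pc maxc] xE cx; apply/negPn/negP => xi.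
pose c' : {ffun T -> option I} := [ffun z => if z == x then Some i else c z].
have cc' j : colour_class c' j =
    if j == i then x |: colour_class c i else colour_class c j.
  apply/setP=> z; rewrite inE ffunE; case: (eqVneq z x) => [->|zx].
    rewrite xE (inj_eq Some_inj) [i == j]eq_sym.
    by case: (j == i); rewrite !inE ?eqxx ?cx ?andbF.
  by case: (eqVneq j i) => [->|_]; rewrite !inE ?(negPf zx).
have xc : x \notin colour_class c i by rewrite inE cx andbF.
have szi : #|colour_class c' i| = #|colour_class c i|.+1.
  by rewrite cc' eqxx cardsU1 xc.
suff: #|colour_class c' i| = #|colour_class c i|.
  by rewrite szi => /eqP; rewrite -[X in _ == X]addn0 -addn1 eqn_add2l.
apply: maxc => [|j].
  by apply/forallP=> j; rewrite cc'; case: eqP => // _; apply: independentU1.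
by rewrite cc'; case: eqP => // ->; rewrite cardsU1 leq_addl.
Qed.

(** The set [C] collects the elements left uncovered by some packing that
    exchanges reach from [c0]. If [c] is reachable and leaves [x] uncovered, each
    element of the circuit that [x] closes in class [i] can be exchanged for [x],
    hence lies in [C]: so [x] is spanned by the part of class [i] inside [C]. Going
    back along the exchanges to [c0] preserves this, because the closure of that
    part only grows: an exchange inserts an element that the part spans already. *)
Theorem maximal_packing_tight c0 : maximal_packing c0 ->
  exists2 C : {set T}, C \subset E &
    (forall x, x \in E -> c0 x = None -> x \in C) /\
    forall i, C \subset cl (colour_class c0 i :&: C).
Proof.
move=> max0.
pose C := [set x in E | [exists c, connect exchange_step c0 c && (c x == None)]].
have CE : C \subset E by apply/subsetP=> x; rewrite inE => /andP[].
have inC c x : connect exchange_step c0 c -> x \in E -> c x = None -> x \in C.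
  by move=> rc xE cx; rewrite inE xE; apply/existsP; exists c; rewrite rc cx.
exists C => //; split=> [x|i]; first exact: inC.
(* The circuit of x in class i is made of elements of C. *)
have free c x : connect exchange_step c0 c -> x \in E -> c x = None ->
    x \in cl (colour_class c i :&: C).
  move=> rc xE cx; have maxc := maximal_packing_reach rc max0.
  have xi := maximal_packing_cl i maxc xE cx.
  have [/forallP pc _] := maxc.
  apply: (subsetP (cl_mono _)) (cl_circuit (pc i) xi).
  apply/subsetP=> y; rewrite !inE => /andP[/[dup] yc /andP[yE cy] xy].
  rewrite yE cy; apply/existsP; exists (exchange c x i y).
  rewrite ffunE eqxx (_ : y == x = false); last first.
    by apply: contraTF cy => /eqP ->; rewrite cx.
  rewrite eqxx andbT; apply: (connect_trans rc); apply: connect1.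
  by apply/exchange_stepP; exists x, i, y; rewrite inE.
(* Undoing exchanges enlarges the closure of class i inside C. *)
have back c : connect exchange_step c0 c ->
    cl (colour_class c i :&: C) \subset cl (colour_class c0 i :&: C).
  case/connectP=> p; elim/last_ind: p c => [|p c1 IHp] c /=; first by move=> _ ->.
  rewrite rcons_path last_rcons => /andP[pp st] ->.
  have rc : connect exchange_step c0 (last c0 p) by apply/connectP; exists p.
  apply: subset_trans (IHp _ pp erefl).
  case/exchange_stepP: st => x [j [y [xE cx yc xy ->]]].
  apply: cl_min; rewrite colour_class_exchange //.
  case: eqP => [ij|_]; last exact: cl_ext.
  apply/subsetP=> z; rewrite inE in_setU1 => /andP[/predU1P[-> _|zc zC]].
    exact: free.
  apply: (subsetP (cl_ext _)); rewrite inE zC andbT.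
  by move: zc; rewrite -ij => /setD1P[].
apply/subsetP=> x /[dup] xC; rewrite inE => /andP[xE /existsP[c /andP[rc /eqP cx]]].
exact: (subsetP (back c rc)) (free c x rc xE cx).
Qed.

Lemma maximal_packing_above c : packing c ->
  exists2 c', maximal_packing c' &
    forall i, (#|colour_class c i| <= #|colour_class c' i|)%N.
Proof.
move=> pc.
pose P c' := packing c' && [forall i, #|colour_class c i| <= #|colour_class c' i|]%N.
have Pc : P c by rewrite /P pc; apply/forallP.
case: (arg_maxnP (fun c' => \sum_i #|colour_class c' i|)%N Pc)
  => c1 /andP[p1 /forallP le1] max1.
exists c1 => //; split=> // c' p' le' i.
have P' : P c'.
  by rewrite /P p'; apply/forallP=> j; apply: leq_trans (le' j).
have le_sum : (\sum_j #|colour_class c' j| <= \sum_j #|colour_class c1 j|)%N.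
  exact: max1.
have /leqif_sum : forall j, true ->
    (#|colour_class c1 j| <= #|colour_class c' j|
      ?= iff (#|colour_class c1 j| == #|colour_class c' j|))%N.
  by move=> j _; split.
case=> le_sum'; rewrite eqn_leq le_sum le_sum' /= => /esym/forallP/(_ i)/eqP.
by move->.
Qed.

End Packing.
End Matroid.

(** * The graphic matroid *)

Section Connectivity.
Variable V : finType.
Implicit Types (F : {set {set V}}) (u v x y z : V).

Lemma eq_set2 x y u v : [set x; y] = [set u; v] ->
  (x = u /\ y = v) \/ (x = v /\ y = u).
Proof.
move=> /setP E.
move: (E x) (E y) (E u) (E v); rewrite !inE !eqxx !orbT /=.
move=> /esym/orP xs /esym/orP ys /orP us /orP vs.
by case: xs => /eqP ?; case: ys => /eqP ?; subst; auto;
  [case: vs|case: us] => /eqP ?; subst; auto.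
Qed.

Lemma edge_rel_sym F : symmetric (edge_rel F).
Proof. by move=> x y; rewrite /edge_rel /= eq_sym setUC. Qed.

Lemma edge_relE F x y : edge_rel F x y = (x != y) && ([set x; y] \in F).
Proof. by []. Qed.

Lemma connect_edge_sym F x y : connect (edge_rel F) x y = connect (edge_rel F) y x.
Proof. exact/sym_connect_sym/edge_rel_sym. Qed.

Lemma connect_pair F x y : [set x; y] \in F -> connect (edge_rel F) x y.
Proof.
by case: (eqVneq x y) => [->|xy xyF]; rewrite ?connect0 //; apply: connect1; apply/andP.
Qed.

Lemma connect_edge_sub F F' :
    (forall x y, [set x; y] \in F -> connect (edge_rel F') x y) ->
  forall x y, connect (edge_rel F) x y -> connect (edge_rel F') x y.
Proof. by move=> FF'; apply: connect_sub => x y /= /andP[_ /FF']. Qed.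

Lemma connect_mono F F' x y : F \subset F' ->
  connect (edge_rel F) x y -> connect (edge_rel F') x y.
Proof.
by move=> /subsetP FF'; apply: connect_edge_sub => u v /FF'; apply: connect_pair.
Qed.

(** Cut a path that uses the new edge [uv] before its first and after its last passage
    through this edge. *)
Lemma connect_setU1 F u v x y :
    connect (edge_rel ([set u; v] |: F)) x y ->
  [\/ connect (edge_rel F) x y,
      connect (edge_rel F) x u /\ connect (edge_rel F) v y
    | connect (edge_rel F) x v /\ connect (edge_rel F) u y].
Proof.
case/connectP=> p + ->; elim: p x => [|z p IHp] x /=.
  by move=> _; apply: Or31.
case/andP=> /andP[xz /setU1P xzF] /IHp{IHp}.
case: xzF => [/eq_set2[[-> ->]|[-> ->]]|xzF].
- by case=> [zy|[_ vy]|[_ uy]]; [apply: Or32|apply: Or32|apply: Or31].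
- by case=> [zy|[_ vy]|[_ uy]]; [apply: Or33|apply: Or31|apply: Or33].
have xz' := connect_pair xzF.
by case=> [zy|[zu vy]|[zv uy]]; [apply: Or31|apply: Or32|apply: Or33];
  do ?split=> //; apply: connect_trans xz' _.
Qed.

(** [F] itself is included so that the operator is extensive on all sets of sets:
    the sets that are not pairs of vertices become coloops. *)
Definition graphic_closure F : {set {set V}} :=
  F :|: [set [set p.1; p.2] | p : V * V & connect (edge_rel F) p.1 p.2].

Lemma graphic_closureP F e :
  reflect (e \in F \/ exists x y, e = [set x; y] /\ connect (edge_rel F) x y)
          (e \in graphic_closure F).
Proof.
rewrite inE; apply: (iffP orP) => -[eF|]; try by left.
  by case/imsetP=> -[x y]; rewrite inE /= => xy ->; right; exists x, y.
case=> x [y [-> xy]]; right; apply/imsetP.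
by exists (x, y) => //; rewrite inE.
Qed.

Lemma mem_graphic_closure F x y :
  ([set x; y] \in graphic_closure F) = connect (edge_rel F) x y.
Proof.
apply/graphic_closureP/idP => [[/connect_pair //|[u [v [/eq_set2 E]]]]|xy].
  by case: E => -[-> ->] //; rewrite connect_edge_sym.
by right; exists x, y.
Qed.

Lemma connect_graphic_closure F x y :
  connect (edge_rel (graphic_closure F)) x y -> connect (edge_rel F) x y.
Proof. by apply: connect_edge_sub => u v; rewrite mem_graphic_closure. Qed.

Lemma graphic_closure_ext F : F \subset graphic_closure F.
Proof. exact: subsetUl. Qed.

Lemma graphic_closure_min F F' : F \subset graphic_closure F' ->
  graphic_closure F \subset graphic_closure F'.
Proof.
move=> FF'; apply/subsetP=> e /graphic_closureP[/(subsetP FF') //|[x [y [-> xy]]]].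
by rewrite mem_graphic_closure; apply/connect_graphic_closure/(connect_mono FF').
Qed.

(** If [F] connects the ends [x] and [y] of [e] only with the help of [f], then [f] is
    an edge [uv], and [e] reconnects [u] to [v] through the two remaining pieces of the
    path from [x] to [y]. *)
Lemma graphic_closure_exch F e f :
    e \in graphic_closure (f |: F) -> e \notin graphic_closure F ->
  f \in graphic_closure (e |: F).
Proof.
case/graphic_closureP=> [/setU1P[->|eF]|[x [y [-> xy]]]].
- by move=> _; apply: (subsetP (graphic_closure_ext _)); apply: setU11.
- by rewrite (subsetP (graphic_closure_ext F) _ eF).
rewrite mem_graphic_closure => nxy.
have [u [v fE]] : exists u v, f = [set u; v].
  case/connectP: xy nxy => p + ->; elim: p x => [|z p IHp] x /=.
    by rewrite connect0.
  case/andP=> /andP[xz /setU1P[<- _ _|xzF]]; first by exists x, z.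
  move=> /IHp{IHp}IHp nxl; apply: IHp; apply: contra nxl.
  by apply: connect_trans; apply: connect_pair.
rewrite {}fE in xy *; rewrite mem_graphic_closure.
have sF : F \subset [set x; y] |: F := subsetUr _ _.
have xy' : connect (edge_rel ([set x; y] |: F)) x y by apply/connect_pair/setU11.
case: (connect_setU1 xy) => [xyF|[xu vy]|[xv uy]]; first by rewrite xyF in nxy.
  rewrite connect_edge_sym in xu; rewrite connect_edge_sym in vy.
  by apply: connect_trans (connect_mono sF xu) _;
     apply: connect_trans xy' (connect_mono sF vy).
rewrite connect_edge_sym.
rewrite connect_edge_sym in xv; rewrite connect_edge_sym in uy.
by apply: connect_trans (connect_mono sF xv) _;
   apply: connect_trans xy' (connect_mono sF uy).
Qed.

(** Independence in the graphic matroid: no edge of [F] joins two vertices that the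
    rest of [F] connects. *)
Definition forest_set F := independent graphic_closure F.

Lemma forest_set_sub F F' : F \subset F' -> forest_set F' -> forest_set F.
Proof. exact: (independent_sub graphic_closure_ext graphic_closure_min). Qed.

(** Going around a cycle the other way connects the ends of its first edge. *)
Lemma forest_set_acyclic F : forest_set F -> acyclic F.
Proof.
move=> iF [|x [|y [|z s]]] //= /andP[/andP[xy Cs] U].
have /andP[xny xyF] := xy; set e := [set x; y] in xyF.
suff: e \in graphic_closure (F :\ e).
  by move/forall_inP: iF => /(_ e xyF)/negPf ->.
rewrite mem_graphic_closure connect_edge_sym.
have path_avoid s' w : w \notin e -> all [predC e] s' ->
    path (edge_rel F) w (rcons s' x) -> path (edge_rel (F :\ e)) w (rcons s' x).
  elim: s' w => [|w' s' IHs] w we /=.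
    rewrite !andbT !edge_relE in_setD1 => _ /andP[-> ->]; rewrite andbT.
    by apply: contraNneq we => <-; rewrite !inE eqxx.
  case/andP=> w'e s'e /andP[/andP[ww' ww'F]] /(IHs _ w'e s'e) ->.
  rewrite edge_relE ww' in_setD1 ww'F !andbT /=.
  by apply: contraNneq we => <-; rewrite !inE eqxx.
move: U Cs; rewrite /= !inE !negb_or -!andbA.
case/and5P=> _ xz xs yz /and3P[ys zs us] /and3P[yz' yzF Cs].
have ze : z \notin e by rewrite !inE negb_or ![z == _]eq_sym xz yz.
apply/connectP; exists (z :: rcons s x); last by rewrite /= last_rcons.
rewrite /= edge_relE yz' in_setD1 yzF andbT /=; apply/andP; split.
  by apply: contraNneq ze => <-; rewrite !inE eqxx orbT.
apply: path_avoid => //; apply/allP=> w ws; rewrite !inE negb_or.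
by rewrite (memPn xs) ?(memPn ys).
Qed.

Lemma component_refl F x : x \in component F x.
Proof. by rewrite inE connect0. Qed.

Lemma component_eq F x y : (component F x == component F y) = connect (edge_rel F) x y.
Proof.
apply/eqP/idP => [E|xy].
  by have := component_refl F y; rewrite -E inE.
apply/setP=> z; rewrite !inE; apply/idP/idP.
  by apply: connect_trans; rewrite connect_edge_sym.
exact: connect_trans.
Qed.

Lemma component_ext F F' :
    F \subset graphic_closure F' -> F' \subset graphic_closure F ->
  component F =1 component F'.
Proof.
move=> FF' F'F x; apply/setP=> y; rewrite !inE; apply/idP/idP => xy.
  exact/connect_graphic_closure/(connect_mono FF').
exact/connect_graphic_closure/(connect_mono F'F).
Qed.

Definition components F : {set {set V}} := [set component F x | x : V].

Lemma components_merge F u v : ~~ connect (edge_rel F) u v ->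
  #|components F| = #|components ([set u; v] |: F)|.+1.
Proof.
move=> nuv; set F' := _ |: F.
set Cu := component F u; set Cv := component F v.
have FF' : F \subset F' := subsetUr _ _.
have uv' : connect (edge_rel F') u v by apply/connect_pair/setU11.
have uCu : u \in Cu := component_refl F u.
have vCv : v \in Cv := component_refl F v.
have comp_uv z : z \in Cu :|: Cv -> component F' z = Cu :|: Cv.
  move=> zuv; transitivity (component F' u).
    apply/eqP; rewrite component_eq connect_edge_sym; move: zuv; rewrite !inE.
    case/orP=> /(connect_mono FF') //; exact: connect_trans.
  apply/setP=> y; rewrite !inE; apply/idP/idP.
    by case/connect_setU1=> [->|[_ ->]|[_ ->]] //; rewrite orbT.
  by case/orP=> /(connect_mono FF') //; apply: connect_trans.
have comp_out z : z \notin Cu :|: Cv -> component F' z = component F z.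
  rewrite !inE negb_or => /andP[uz vz]; apply/setP=> y; rewrite !inE.
  apply/idP/idP; last exact: connect_mono.
  rewrite connect_edge_sym in uz; rewrite connect_edge_sym in vz.
  by case/connect_setU1=> [//|[zu]|[zv]]; [rewrite zu in uz|rewrite zv in vz].
have Cuv : Cu != Cv by rewrite component_eq.
have memF z : component F z \in components F by apply: imset_f.
have -> : components F' = (Cu :|: Cv) |: (components F :\ Cu :\ Cv).
  apply/setP=> S; apply/imsetP/setU1P.
    case=> z _ ->; case: (boolP (z \in Cu :|: Cv)) => zuv.
      by left; rewrite comp_uv.
    right; rewrite comp_out // !in_setD1 memF andbT.
    move: zuv; rewrite inE negb_or => /andP[zu zv].
    apply/andP; split; first by apply: contraNneq zv => <-; apply: component_refl.
    by apply: contraNneq zu => <-; apply: component_refl.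
  case=> [->|].
    by exists u => //; rewrite comp_uv // inE uCu.
  rewrite !in_setD1 => /and3P[Sv Su /imsetP[z _ SE]]; exists z => //.
  rewrite comp_out // inE negb_or; move: Su Sv; rewrite SE !component_eq.
  by rewrite !inE ![connect _ z _]connect_edge_sym => -> ->.
rewrite cardsU1 (cardsD1 Cu) (cardsD1 Cv) !in_setD1 !memF eq_sym Cuv.
suff /negPf-> : Cu :|: Cv \notin components F by rewrite !andbF.
apply/imsetP=> -[z _ E].
have zu : connect (edge_rel F) z u.
  by have : u \in component F z; [rewrite -E inE uCu|rewrite inE].
have zv : connect (edge_rel F) z v.
  by have : v \in component F z; [rewrite -E inE vCv orbT|rewrite inE].
by move: nuv; rewrite (connect_trans _ zv) // connect_edge_sym.
Qed.
End Connectivity.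

(** * Counting edges of forests *)

Section Forests.
Variables (V : finType) (G : sgraph V).
Implicit Types (F : {set {set V}}) (u v x y z : V).

Lemma edgesP e : reflect (exists x y, e = [set x; y] /\ adj G x y) (e \in edges G).
Proof.
apply: (iffP imsetP) => [[[x y] xy ->]|[x [y [-> xy]]]].
  by exists x, y; split=> //; move: xy; rewrite inE.
by exists (x, y) => //; rewrite inE.
Qed.

Lemma forest_set_card F : F \subset edges G -> forest_set F ->
  (#|F| + #|components F| = #|V|)%N.
Proof.
have [m] := ubnP #|F|; elim: m F => // m IHm F ltFm FE iF.
have [->|[e eF]] := set_0Vmem F.
  rewrite cards0 card_imset => [|x y /eqP].
    by rewrite add0n; apply: eq_card.
  rewrite component_eq => /connectP[[|z p] //= /andP[]].
  by rewrite edge_relE in_set0 andbF.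
have [u [v [eE uv]]] := edgesP _ (subsetP FE e eF).
have nuv : ~~ connect (edge_rel (F :\ e)) u v.
  by rewrite -mem_graphic_closure -eE; apply: (forall_inP iF).
have := components_merge nuv; rewrite -eE setD1K // => E.
rewrite (cardsD1 e F) eF add1n addSnnS -E.
apply: IHm.
- by rewrite (cardsD1 e F) eF in ltFm.
- by apply: subset_trans FE; apply: subsetDl.
by apply: forest_set_sub iF; apply: subsetDl.
Qed.

Lemma components_gt0 F x : (0 < #|components F|)%N.
Proof. by apply/card_gt0P; exists (component F x); apply: imset_f. Qed.

Lemma components1_connected F : #|components F| = 1%N ->
  forall x y, connect (edge_rel F) x y.
Proof.
move=> /eqP/cards1P[S E] x y.
have inS z : component F z = S by apply/set1P; rewrite -E; apply: imset_f.
by rewrite -component_eq !inS.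
Qed.

Lemma forest_set_is_forest F : F \subset edges G -> forest_set F -> is_forest G F.
Proof. by move=> FE iF; split=> //; apply: forest_set_acyclic. Qed.

Lemma forest_set_spanning F : F \subset edges G -> forest_set F ->
  #|components F| = 1%N -> is_spanning_tree G F.
Proof.
move=> FE iF c1; split; first exact: forest_set_is_forest.
exact: components1_connected.
Qed.

(** The edges of [F] inside the component of [x] form a forest in which this
    component is still connected, and which has at most one more component for
    each vertex outside. *)
Lemma component_edges_card F x : F \subset edges G -> forest_set F ->
  (#|component F x| <= #|component_edges F x|.+1)%N.
Proof.
move=> FE iF; set Fx := component_edges F x; set Cx := component F x.
have FxF : Fx \subset F by apply/subsetP=> e; rewrite inE => /andP[].
have conn y : y \in Cx -> connect (edge_rel Fx) x y.
  rewrite inE => /connectP[p]; elim/last_ind: p y => [|p z IHp] y /=.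
    by move=> _ ->.
  rewrite rcons_path last_rcons => /andP[pp lz] ->.
  apply: connect_trans (IHp _ pp erefl) (connect1 _).
  have xl : last x p \in Cx by rewrite inE; apply/connectP; exists p.
  have /andP[lnz lzF] := lz; rewrite edge_relE lnz inE lzF.
  apply/subsetP=> w /set2P[] -> //; rewrite inE; rewrite inE in xl.
  exact: connect_trans xl (connect1 lz).
have cFx : (#|components Fx| <= #|~: Cx|.+1)%N.
  pose D := component Fx x |: [set component Fx y | y in ~: Cx].
  have leD : (#|D| <= #|~: Cx|.+1)%N.
    by rewrite cardsU1 -add1n; apply: leq_add (leq_b1 _) (leq_imset_card _ _).
  apply: leq_trans leD; apply: subset_leq_card.
  apply/subsetP=> S /imsetP[y _ ->]; case: (boolP (y \in Cx)) => yx.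
    by apply/setU1P; left; apply/eqP; rewrite eq_sym component_eq conn.
  by apply/setU1P; right; apply: imset_f; rewrite inE.
have := forest_set_card (subset_trans FxF FE) (forest_set_sub FxF iF).
rewrite -(cardsC Cx) => E.
by rewrite -(leq_add2r #|~: Cx|) -E addSnnS leq_add2l.
Qed.

Lemma components_cover F (d : nat) : (forall x, #|component F x| <= d)%N ->
  (#|V| <= #|components F| * d)%N.
Proof.
move=> le_d; have -> : #|V| = (\sum_(x : V) 1)%N by rewrite sum1_card.
rewrite (partition_big (component F) [in components F]); last first.
  by move=> x _; apply: imset_f.
rewrite -sum_nat_const; apply: leq_sum => S /imsetP[x _ ->].
apply: leq_trans (le_d x); rewrite -sum1_card; apply/eq_leq/eq_bigl => y.
by rewrite component_eq connect_edge_sym inE.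
Qed.

Definition forest_packing I := @packing _ (@graphic_closure V) I (edges G).
Definition maximal_forest_packing I :=
  @maximal_packing _ (@graphic_closure V) I (edges G).

(** The hard half of the Nash-Williams and Tutte theorem. In the set [C] given by
    [maximal_packing_tight] each class spans [C], so it has as many edges in [C] as
    a spanning forest of [C], and all edges outside [C] are covered. *)
Lemma forest_packing_tight (I : finType) (c : {ffun {set V} -> option I}) :
    maximal_forest_packing c ->
  exists2 C : {set {set V}}, C \subset edges G &
    (\sum_i #|colour_class (edges G) c i| + #|I| * #|components C| =
     #|edges G :\: C| + #|I| * #|V|)%N.
Proof.
move=> maxc.
have [C CE [freeC tight]] := maximal_packing_tight (@graphic_closure_ext V)
  (@graphic_closure_min V) (@graphic_closure_exch V) maxc.
exists C => //; set cc := colour_class (edges G) c.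
have ccE i : cc i \subset edges G by apply/subsetP=> e; rewrite inE => /andP[].
have [/forallP pc _] := maxc.
have inC i : (#|cc i :&: C| + #|components C| = #|V|)%N.
  have sub : cc i :&: C \subset cc i := subsetIl _ _.
  have -> : components C = components (cc i :&: C).
    apply: eq_imset => x; apply: component_ext; first exact: tight.
    by apply: subset_trans (graphic_closure_ext C); apply: subsetIr.
  exact: forest_set_card (subset_trans sub (ccE i)) (forest_set_sub sub (pc i)).
have outC : (\sum_i #|cc i :\: C| = #|edges G :\: C|)%N.
  rewrite -sum1_card [in RHS](eq_bigr (fun e => \sum_i (c e == Some i))%N); last first.
    move=> e /setDP[eE eC]; case ce : (c e) => [i|]; last first.
      by rewrite (freeC e eE ce) in eC.
    rewrite (bigD1 i) //= eqxx big1 // => j ji.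
    by rewrite (inj_eq Some_inj) eq_sym (negPf ji).
  rewrite exchange_big /=; apply: eq_bigr => i _.
  rewrite -sum1_card big_mkcond /= [RHS]big_mkcond /=; apply: eq_bigr => e _.
  by rewrite !inE; case: (_ == _); rewrite ?andbT ?andbF //; case: ifP.
rewrite -outC -!sum_nat_const -!big_split /=; apply: eq_bigr => i _.
by rewrite -(cardsID C (cc i)) addnAC inC addnC.
Qed.

Lemma maximal_forest_packing_above (I : finType) (c : {ffun {set V} -> option I}) :
    forest_packing c ->
  exists2 c', maximal_forest_packing c' &
    forall i, (#|colour_class (edges G) c i| <= #|colour_class (edges G) c' i|)%N.
Proof. exact: maximal_packing_above. Qed.

End Forests.

(** * Edge cuts between components *)

Section Cuts.
Local Open Scope nat_scope.
Variables (V : finType) (G : sgraph V).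
Implicit Types (C : {set {set V}}) (S T : {set V}).

Definition cut S T : nat := \sum_(u in S) \sum_(v in T) adj G u v.

Lemma sum_components C (f : V -> nat) :
  \sum_(S in components C) \sum_(u in S) f u = \sum_u f u.
Proof.
rewrite [RHS](partition_big (component C) [in components C]); last first.
  by move=> x _; apply: imset_f.
apply: eq_bigr => S /imsetP[x _ ->]; apply: eq_bigl => y.
by rewrite component_eq connect_edge_sym inE.
Qed.

(** An edge that leaves a component of [C] is not in [C], and it is counted from
    both of its ends. *)
Lemma sum_cut_components C :
  \sum_(S in components C) cut S (~: S) <= 2 * #|edges G :\: C|.
Proof.
pose cross (p : V * V) := adj G p.1 p.2 && ([set p.1; p.2] \in edges G :\: C).
have -> : \sum_(S in components C) cut S (~: S) =
    \sum_u \sum_(v in ~: component C u) adj G u v.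
  rewrite -(sum_components C); apply: eq_bigr => S /imsetP[x _ ->].
  by apply: eq_bigr => u; rewrite inE -component_eq => /eqP ->.
apply: (@leq_trans (\sum_(p | cross p) 1)); last first.
  rewrite (partition_big (fun p => [set p.1; p.2]) [in edges G :\: C]) /=; last first.
    by move=> p /andP[].
  rewrite mulnC -sum_nat_const; apply: leq_sum => e /setDP[/edgesP[x [y [-> _]]] _].
  rewrite sum1_card; apply: (@leq_trans #|[set (x, y); (y, x)]|); last first.
    by rewrite cards2; case: eqP.
  apply/subset_leq_card/subsetP => -[u v]; rewrite unfold_in => /andP[_ /eqP/=].
  by case/eq_set2=> -[-> ->]; rewrite !inE eqxx ?orbT.
rewrite -(pair_big_dep xpredT (fun u v => cross (u, v)) (fun _ _ => 1)) /=.
apply: leq_sum => u _; rewrite [leqRHS]big_mkcond [leqLHS]big_mkcond /=.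
apply: leq_sum => v _; rewrite /cross /= !inE.
case: ifP => // nuv; case uv: (adj G u v) => //=.
have -> : [set u; v] \in edges G by apply/edgesP; exists u, v.
by rewrite andbT; case: ifP => // /negbFE /connect_pair; rewrite (negPf nuv).
Qed.

Lemma sum_cut_le C S : S \in components C ->
  \sum_(T in components C | T != S) cut S T <= cut S (~: S).
Proof.
move=> SC; rewrite exchange_big /=; apply: leq_sum => u uS.
rewrite big_mkcondr /= -(leq_add2l (\sum_(v in S) adj G u v)).
have -> : \sum_(v in S) adj G u v + \sum_(v in ~: S) adj G u v = \sum_v adj G u v.
  rewrite [RHS](bigID [in S]) /=; congr (_ + _).
  by apply: eq_bigl => v; rewrite inE.
rewrite -(sum_components C) [leqRHS](bigD1 S) //= leq_add2l.
rewrite [leqRHS]big_mkcondr /=.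
by apply: leq_sum.
Qed.

(** Each of the [#|S|] vertices has at least [d.+1 - #|S|] neighbours outside, and
    [s * (d + 1 - s)] is at least [d] for [s] between [1] and [d]. *)
Lemma small_cut (d : nat) S : (forall v, d <= degree G v) -> 0 < #|S| <= d ->
  d <= cut S (~: S).
Proof.
move=> deg /andP[S0 Sd].
have row u : u \in S -> d.+1 - #|S| <= \sum_(v in ~: S) adj G u v.
  move=> uS; rewrite leq_subLR.
  have -> : \sum_(v in ~: S) adj G u v = #|[set w | adj G u w] :\: S|.
    rewrite -sum1_card big_mkcond [RHS]big_mkcond /=; apply: eq_bigr => v _.
    by rewrite !inE; case: (v \in S) => //=; case: adj.
  apply: leq_ltn_trans (deg u) _; rewrite /degree -(cardsID S) -addSn.
  rewrite leq_add2r; apply: proper_card; apply/properP; split; first exact: subsetIr.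
  by exists u => //; rewrite !inE adj_irr.
apply: (@leq_trans (\sum_(u in S) (d.+1 - #|S|))); last exact: leq_sum.
by rewrite sum_nat_const; nia.
Qed.

(** After division by [d] the bound reads [2 * (k + (d - 1) / d)], which is less than
    the number [2 * k + 2] of edges that leave a set of at most [d] vertices. *)
Definition separated (k d : nat) := forall S T : {set V},
  [disjoint S & T] -> d < #|S| -> d < #|T| -> cut S (~: S) <= cut T (~: T) ->
  2 * (k.+1 * d).-1 <= d * (cut T (~: T) + cut S T).

(** Let [S1] be a component of [C] with the fewest leaving edges. Each other
    component [S] satisfies
    [2 * k.+1 * d <= d * (cut S (~: S) + cut S1 S) + 2 * (d < #|S|)],
    by separation if [S] is large and by [small_cut] otherwise. Summing over [S], the
    terms [cut S1 S] add up to the edges that leave [S1], so that the left factor is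
    the sum of all cuts. The error [q] is the number of large components other than
    [S1], and these are few because they are large. *)
Lemma separated_components (C : {set {set V}}) (k d : nat) : 0 < #|V| ->
    (forall v, d <= degree G v) -> 2 * k + 2 <= d -> separated k d ->
  exists2 q, q * d.+1 < #|V| /\ q < #|components C| &
    k.+1 * d * #|components C| <= d * #|edges G :\: C| + q + k.+1 * d.
Proof.
move=> V0 deg dk sep.
have [x0 _] := card_gt0P V0.
have [S1 S1C minS1] := @arg_minnP _ (component C x0) [in components C]
  (fun S => cut S (~: S)) (imset_f _ (erefl _)).
pose big S := [&& S \in components C, S != S1 & d < #|S|].
pose q := \sum_(S | big S) 1.
exists q.
  have S1_gt0 : 0 < #|S1|.
    by case/imsetP: S1C => x _ ->; apply/card_gt0P; exists x; apply: component_refl.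
  have qn : q * d.+1 + #|S1| <= #|V|.
    have -> : #|V| = \sum_(x : V) 1 by rewrite sum1_card.
    rewrite -(sum_components C) (bigD1 S1) //= sum1_card addnC leq_add2l.
    rewrite big_distrl /=; apply: leq_trans (_ : \sum_(S | big S) #|S| <= _).
      by apply: leq_sum => S /and3P[_ _]; rewrite mul1n.
    rewrite [leqRHS](bigID (fun S => d < #|S|)) /=.
    apply: leq_trans (leq_addr _ _).
    rewrite (eq_bigl (fun S => (S \in components C) && (S != S1) && (d < #|S|))).
      by apply: leq_sum => S _; rewrite sum1_card.
    by move=> S; rewrite /big andbA.
  split; first lia.
  rewrite -sum1_card [ltnRHS](bigD1 S1) //= add1n ltnS /q.
  rewrite [leqRHS](bigID (fun S => d < #|S|)) /=.
  apply: leq_trans (leq_addr _ _).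
  by rewrite (eq_bigl (fun S => (S \in components C) && (S != S1) && (d < #|S|)))
    // => S; rewrite /big andbA.
have part S : S \in components C -> S != S1 ->
    2 * (k.+1 * d) <= d * (cut S (~: S) + cut S1 S) + 2 * (d < #|S|).
  move=> SC SS1; have S0 : 0 < #|S|.
    by case/imsetP: SC => x _ ->; apply/card_gt0P; exists x; apply: component_refl.
  case: (ltnP d #|S|) => dS /=; last first.
    have := @small_cut d S deg; rewrite S0 dS => /(_ isT); nia.
  have le1 := minS1 S SC; have S1_gt0 : 0 < #|S1|.
    by case/imsetP: S1C => x _ ->; apply/card_gt0P; exists x; apply: component_refl.
  case: (ltnP d #|S1|) => [d1|S1d]; last first.
    have := @small_cut d S1 deg; rewrite S1_gt0 S1d => /(_ isT); nia.
  have dis : [disjoint S1 & S].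
    case/imsetP: S1C SC SS1 => x _ -> /imsetP[y _ ->].
    apply: contraNT => /pred0Pn[z /=]; rewrite !inE => /andP[xz yz].
    rewrite component_eq; apply: connect_trans yz _.
    by rewrite connect_edge_sym.
  have := sep S1 S dis d1 dS le1; nia.
have sum_part : 2 * (k.+1 * d) * #|components C| <=
   d * (\sum_(S in components C) cut S (~: S)) + 2 * q + 2 * (k.+1 * d).
  rewrite -sum1_card (bigD1 S1) //= mulnDr muln1 addnC leq_add2r.
  have le1 := sum_cut_le S1C.
  apply: (@leq_trans (d * (\sum_(S in components C | S != S1) cut S (~: S) +
      \sum_(S in components C | S != S1) cut S1 S) + 2 * q)).
    rewrite -big_split big_distrr [d * _]big_distrr /=.
    have -> : q = \sum_(S in components C | S != S1) (d < #|S|).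
      rewrite /q big_mkcond [RHS]big_mkcond /=; apply: eq_bigr => S _.
      by rewrite /big; case: (_ \in _) => //=; case: (_ == _) => //=; case: ltnP.
    rewrite [2 * \big[_/_]_(_ <- _ | _) _]big_distrr -big_split /=.
    apply: leq_sum => S /andP[SC SS1].
    by rewrite muln1; apply: part.
  rewrite leq_add2r leq_mul2l; apply/orP; right.
  by rewrite [leqRHS](bigD1 S1) //= addnC leq_add2r.
have := sum_cut_components C; nia.
Qed.
End Cuts.

(** * From separation to spanning trees and a forest *)

Section Decomposition.
Local Open Scope nat_scope.
Variables (V : finType) (G : sgraph V).

Lemma spanning_forest_set (F : {set {set V}}) : F \subset edges G -> forest_set F ->
  #|F| = #|V|.-1 -> 0 < #|V| -> is_spanning_tree G F.
Proof.
move=> FE iF szF /card_gt0P[x _]; apply: forest_set_spanning => //.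
by have := forest_set_card FE iF; have := components_gt0 F x; lia.
Qed.

(** A maximal packing of [k] forests consists of spanning trees, by the edge count of
    [separated_components]. Extending it to a maximal packing of [k] trees and a
    further forest [F], the same count shows that [F] has few components:
    [d * (#|components F| - 1) <= q] with [q * d.+1 < #|V|]. This gives the size
    of [F]; and if [F] is disconnected, its components cannot all have at most [d]
    vertices, for there are too few of them. *)
Theorem separation_property_P (k d : nat) : 0 < #|V| ->
    (forall v, d <= degree G v) -> 2 * k + 2 <= d -> separated G k d ->
  property_P G k d.
Proof.
move=> V0 deg dk sep; have [x0 _] := card_gt0P V0.
have V1 : 1 < #|V|.
  have : degree G x0 <= #|V| by apply: max_card.
  have := deg x0; lia.
pose cc (I : finType) := @colour_class _ I (edges G).
have ccE (I : finType) c i : cc I c i \subset edges G.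
  by apply/subsetP=> e; rewrite inE => /andP[].
have forest0 : forest_set (set0 : {set {set V}}).
  by apply/forall_inP=> x; rewrite inE.
have [|c1 max1 _] := @maximal_forest_packing_above _ G 'I_k [ffun=> None].
  apply/forallP=> i; have -> // : colour_class (edges G) [ffun=> None] i = set0.
  by apply/setP=> e; rewrite !inE ffunE andbF.
have size1 i : #|cc _ c1 i| = #|V|.-1.
  have [/forallP p1 _] := max1.
  have le1 j : #|cc _ c1 j| <= #|V|.-1.
    by have := forest_set_card (ccE _ c1 j) (p1 j);
       have := components_gt0 (cc _ c1 j) x0; rewrite /cc; lia.
  have [C _] := forest_packing_tight max1; rewrite card_ord => tight.
  have [q [_ qC] cnt] := separated_components C V0 deg dk sep.
  have : \sum_(j < k) #|cc _ c1 j| = \sum_(j < k) #|V|.-1.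
    apply/eqP; rewrite eqn_leq leq_sum //= sum_nat_const card_ord.
    have d0 : 0 < d by lia.
    rewrite -(leq_pmul2l d0).
    move: tight cnt; rewrite -/(cc _).
    set s := \sum_(j < k) _; set t := #|components C|; set m := #|_ :\: _|.
    move=> tight cnt.
    (* (d - 1) * (t - 1) is nonnegative *)
    have h1 : t + d <= d * t + 1 by nia.
    have h2 := congr1 (muln d) tight.
    case: #|V| V0 h2 => // n' _ h2 /=; lia.
  have /leqif_sum := fun j (_ : true) => leqif_eq (le1 j).
  by case=> _ E /eqP; rewrite E => /forallP/(_ i)/eqP.
(* The class None of c2, empty so far, is the one that becomes the forest. *)
pose c2 : {ffun {set V} -> option (option 'I_k)} := [ffun e => omap Some (c1 e)].
have c2S i : cc _ c2 (Some i) = cc _ c1 i.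
  by apply/setP=> e; rewrite !inE ffunE; case: (c1 e) => [a|] //=.
have c2N : cc _ c2 None = set0.
  by apply/setP=> e; rewrite !inE ffunE; apply/negP=> /andP[_ /eqP]; case: (c1 e).
have [|c3 max3 le3] := @maximal_forest_packing_above _ G _ c2.
  have [/forallP p1 _] := max1.
  apply/forallP=> -[i|]; first by move: (c2S i); rewrite /cc => ->.
  by move: c2N; rewrite /cc => ->.
have [/forallP p3 _] := max3.
have size3 i : #|cc _ c3 (Some i)| = #|V|.-1.
  have := le3 (Some i); rewrite -/(cc _ c2 _) c2S size1.
  have := forest_set_card (ccE _ c3 (Some i)) (p3 (Some i)).
  have := components_gt0 (cc _ c3 (Some i)) x0.
  by rewrite /cc; lia.
have disj i j : i != j -> [disjoint cc _ c3 i & cc _ c3 j].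
  move=> ij; apply/pred0P=> e /=; rewrite !inE.
  by apply: contraNF ij => /andP[/andP[_ /eqP->] /andP[_ /eqP[->]]].
pose F := cc _ c3 None.
have cF := forest_set_card (ccE _ c3 None) (p3 None); rewrite -/(cc _ c3 _) -/F in cF.
have [C _] := forest_packing_tight max3; rewrite card_option card_ord => tight.
have [q [qV qC] cnt] := separated_components C V0 deg dk sep.
have sumE : \sum_i #|cc _ c3 i| = #|F| + k * #|V|.-1.
  rewrite (bigD1 None) //=; congr (_ + _).
  have size_other o : o != None -> #|cc _ c3 o| = #|V|.-1.
    by case: o => [i _|//]; apply: size3.
  by rewrite (eq_bigr _ size_other) sum_nat_const cardC1 card_option card_ord.
have key : d * #|components F| <= q + d.
  move: tight cnt; rewrite -/(cc _ c3) sumE.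
  set t := #|components C|; set m := #|_ :\: _|.
  move=> tight cnt; nia.
exists (fun i => cc _ c3 (Some i)), F; split.
- split=> [i|i j ij]; last exact: disj.
  exact: spanning_forest_set (ccE _ _ _) (p3 _) (size3 i) V0.
- split; first exact: forest_set_is_forest (ccE _ _ _) (p3 _).
  by move=> i; apply: disj.
- have d0 : 0 < d by lia.
  rewrite mulrAC ltr_pdivrMr ?ltr0n // -!(natrB _ (n := 1)) // -?natrM ?ltr_nat //; nia.
move=> nspan; apply/existsP; apply: contraT; rewrite negb_exists => /forallP small.
have cF2 : 1 < #|components F|.
  rewrite ltn_neqAle (components_gt0 F x0) andbT; apply/eqP=> cF1.
  by apply: nspan; apply: forest_set_spanning (ccE _ _ _) (p3 _) _.
have : #|V| <= #|components F| * d.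
  apply: components_cover => x.
  apply: leq_trans (component_edges_card x (ccE _ c3 None) (p3 None)) _.
  by rewrite ltnNge small.
nia.
Qed.

End Decomposition.

(** * Rayleigh quotients and eigenvalues of real symmetric matrices *)

Local Open Scope ring_scope.

Lemma char_poly_conj (F : comUnitRingType) n (P A : 'M[F]_n) :
  P \in unitmx -> char_poly (invmx P *m A *m P) = char_poly A.
Proof.
move=> uP; have PV : map_mx polyC (invmx P) *m map_mx polyC P = 1%:M.
  by rewrite -map_mxM mulVmx // map_mx1.
rewrite /char_poly; have -> : char_poly_mx (invmx P *m A *m P) =
    map_mx polyC (invmx P) *m char_poly_mx A *m map_mx polyC P.
  rewrite /char_poly_mx !map_mxM mulmxBr mulmxBl; congr (_ - _).
  by rewrite scalar_mxC -mulmxA PV mulmx1.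
by rewrite !det_mulmx mulrAC -det_mulmx PV det1 mul1r.
Qed.

Section CourantFischer.
Variables (R : rcfType) (n : nat).
Local Open Scope sesquilinear_scope.
Local Notation C := (complex R).
Local Notation toC := (real_complex R).

Definition qform (M : 'M[R]_n) (x : 'rV[R]_n) : R := (x *m M *m x^T) 0 0.

Lemma conjC_toC (x : R) : (toC x)^* = toC x.
Proof. by apply: conj_Creal; rewrite complex_real. Qed.

Lemma map_mx_trC p q (A : 'M[R]_(p, q)) : (map_mx toC A)^t* = map_mx toC A^T.
Proof. by apply/matrixP=> i j; rewrite !mxE conjC_toC. Qed.

(** A real symmetric matrix is Hermitian: it is diagonalizable over the complex numbers,
    and the reality of its eigenvalues brings the factorization of its characteristic
    polynomial back to the real field. *)
Lemma spectral_toC (M : 'M[R]_n) : M^T = M ->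
  exists (U : 'M[C]_n) (d : 'rV[R]_n),
    [/\ U \is unitarymx, map_mx toC M = U^t* *m diag_mx (map_mx toC d) *m U
      & char_poly M = \prod_i ('X - (d 0 i)%:P)].
Proof.
move=> symM; set Mc := map_mx toC M.
have hM : Mc \is hermsymmx.
  by apply/is_hermitianmxP; rewrite expr0 scale1r map_mx_trC symM.
have /orthomx_spectralP MU := hermitian_normalmx hM.
have /mxOverP realD := hermitian_spectral_diag_real hM.
have UU := spectral_unitarymx Mc.
set U := spectralmx Mc in MU UU; set D := spectral_diag Mc in MU realD.
pose d : 'rV[R]_n := \row_i complex.Re (D 0 i).
have dD : D = map_mx toC d.
  by apply/rowP=> i; rewrite !mxE RRe_real.
exists U, d; split=> //; first by rewrite -invmx_unitary // -dD.
apply: (map_poly_inj toC); rewrite map_char_poly -/Mc MU.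
rewrite char_poly_conj ?unitarymx_unit //.
rewrite char_poly_trig ?diag_mx_is_trig // rmorph_prod; apply: eq_bigr => i _.
by rewrite !mxE eqxx mulr1n dD mxE rmorphB /= map_polyX map_polyC.
Qed.

Lemma form_diag (U : 'M[C]_n) (e : 'rV[C]_n) (z : 'rV[C]_n) :
  let g := z *m U^t* in
  (z *m (U^t* *m diag_mx e *m U) *m z^t*) 0 0 = \sum_i e 0 i * `|g 0 i| ^+ 2.
Proof.
move=> g; have -> : z *m (U^t* *m diag_mx e *m U) *m z^t* = g *m diag_mx e *m g^t*.
  by rewrite /g trmx_mul map_mxM trmxCK !mulmxA.
rewrite mxE; apply: eq_bigr => i _.
by rewrite mul_mx_diag !mxE normCK mulrAC mulrC.
Qed.

(** The cross terms cancel by symmetry, so the Hermitian form of a complex vector is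
    the sum of the values of the real form at its two parts. *)
Lemma form_complex (N : 'M[R]_n) (u v : 'rV[R]_n) : N^T = N ->
  let z := map_mx toC u + 'i *: map_mx toC v in
  (z *m map_mx toC N *m z^t*) 0 0 = toC (qform N u + qform N v).
Proof.
move=> symN z.
have zt : z^t* = map_mx toC u^T - 'i *: map_mx toC v^T.
  by apply/matrixP=> i j; rewrite !mxE rmorphD rmorphM /= conjCi !conjC_toC mulNr.
have uv : u *m N *m v^T = v *m N *m u^T.
  transitivity (u *m N *m v^T)^T; last by rewrite !trmx_mul trmxK symN mulmxA.
  by apply/matrixP=> i j; rewrite !ord1 [RHS]mxE.
rewrite zt mulmxDl mulmxBr !mulmxDl -!scalemxAl -!scalemxAr -!map_mxM uv.
rewrite opprD addrA addrK scalerA -expr2 sqrCi scaleN1r opprK -map_mxD mxE.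
by rewrite mxE.
Qed.

(** Half of Sylvester's law of inertia. The [m] rows of [W] have a nontrivial complex
    combination without coordinates along the fewer than [m] positive eigenvalues. The
    Hermitian form is nonpositive there, hence so is the real form at the real or at
    the imaginary part; one of these works even if the other one vanishes. *)
Lemma nonpositive_form m (W : 'M[R]_(m, n)) (N : 'M[R]_n) (U : 'M[C]_n)
    (e : 'rV[R]_n) :
    N^T = N -> map_mx toC N = U^t* *m diag_mx (map_mx toC e) *m U ->
    (#|[pred i | (0 < e 0 i)%R]| < m)%N ->
  exists2 x : 'rV[R]_m, x != 0 & qform N (x *m W) <= 0.
Proof.
move=> symN NE ltIm; pose I := [pred i | 0 < e 0 i].
pose B : 'M[C]_(m, #|I|) :=
  \matrix_(r, j) (map_mx toC W *m U^t*) r (enum_val j).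
have [y y0 yB] : exists2 y : 'rV[C]_m, y != 0 & y *m B = 0.
  have : kermx B != 0.
    rewrite kermx_eq0 /row_free neq_ltn (leq_ltn_trans (rank_leq_col B)) //.
  by case/rowV0Pn => y /sub_kermxP yB y0; exists y.
pose u := \row_j complex.Re (y 0 j); pose v := \row_j complex.Im (y 0 j).
have yE : y = map_mx toC u + 'i *: map_mx toC v.
  by apply/rowP=> j; rewrite !mxE [LHS]complexE.
have le0 : qform N (u *m W) + qform N (v *m W) <= 0.
  rewrite -lecR -form_complex // NE !map_mxM scalemxAl -mulmxDl -yE form_diag.
  apply: sumr_le0 => i _; case: (boolP (i \in I)) => iI.
    suff -> : (y *m map_mx toC W *m U^t*) 0 i = 0 by rewrite normr0 expr0n mulr0.
    have := congr1 (fun A : 'rV__ => A 0 (enum_rank_in iI i)) yB.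
    rewrite [RHS]mxE => <-; rewrite -mulmxA !mxE; apply: eq_bigr => r _.
    by rewrite [B _ _]mxE enum_rankK_in.
  by rewrite mxE mulr_le0_ge0 ?exprn_ge0 // lecR leNgt; exact: iI.
have u0v0 : (u != 0) || (v != 0).
  rewrite -negb_and; apply: contra y0 => /andP[/eqP u0 /eqP v0].
  by rewrite yE u0 v0 !map_mx0 scaler0 addr0.
case: (lerP (qform N (u *m W)) 0) => qu; last first.
  exists v; last first.
    rewrite -(lerD2l (qform N (u *m W))); apply: le_trans le0 _.
    by rewrite addr0 ltW.
  apply: contraTneq le0 => ->; rewrite mul0mx [X in _ + X](_ : _ = 0).
    by rewrite addr0 -ltNge.
  by rewrite /qform !mul0mx mxE.
have [u0|] := eqVneq u 0; last by exists u.
move: u0v0 le0; rewrite u0 eqxx /= => v0; rewrite mul0mx /qform !mul0mx mxE add0r => qv.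
by exists v.
Qed.

Lemma spectral_affine (M : 'M[R]_n) (U : 'M[C]_n) (d : 'rV[R]_n) (a b : R) :
    U \is unitarymx -> map_mx toC M = U^t* *m diag_mx (map_mx toC d) *m U ->
  map_mx toC (a *: M + b%:M) =
    U^t* *m diag_mx (map_mx toC (a *: d + const_mx b)) *m U.
Proof.
move=> UU MU.
have -> : diag_mx (map_mx toC (a *: d + const_mx b)) =
    toC a *: diag_mx (map_mx toC d) + (toC b)%:M.
  apply/matrixP=> i j; rewrite !mxE; case: (i == j) => /=.
    by rewrite !mulr1n rmorphD rmorphM.
  by rewrite !mulr0n mulr0 addr0.
rewrite mulmxDr mulmxDl -scalemxAr -scalemxAl -MU mul_mx_scalar -scalemxAl.
rewrite -invmx_unitary // mulVmx ?unitarymx_unit // scalemx1.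
by rewrite map_mxD map_mxZ map_scalar_mx.
Qed.

End CourantFischer.

Section RayleighBounds.
Variables (R : realType) (n : nat).
Implicit Types (M : 'M[R]_n).

Lemma perm_eigenvalues M (d : 'rV[R]_n) :
    char_poly M = \prod_i ('X - (d 0 i)%:P) ->
  perm_eq (eigenvalues M) [seq d 0 i | i <- enum 'I_n].
Proof.
move=> Md; set s := [seq _ | _ <- _].
have -> : eigenvalues M = sort >=%R s.
  apply: eigenvalues_unique; first by apply: sort_sorted => x y; apply: le_total.
  rewrite (perm_big s) ?perm_sort //= big_map big_enum.
  exact: Md.
by rewrite perm_sort.
Qed.

Lemma card_eigenvalues M (d : 'rV[R]_n) (P : pred R) :
    char_poly M = \prod_i ('X - (d 0 i)%:P) ->
  #|[pred i | P (d 0 i)]| = count P (eigenvalues M).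
Proof.
move=> /perm_eigenvalues/permP ->.
by rewrite count_map enumT cardE /enum_mem size_filter.
Qed.

Lemma sorted_ge_nth (s : seq R) i j : sorted >=%R s ->
  (i <= j < size s)%N -> s`_j <= s`_i.
Proof.
move=> ss /andP[ij js].
by apply: (sorted_leq_nth (rev_trans le_trans) lexx 0 ss) => //; rewrite ?inE //;
  apply: leq_ltn_trans js.
Qed.

(** Affine functions of [M] serve for both ends of the spectrum: [a] is [1] or [-1],
    and [- a * b] is the eigenvalue of interest. *)
Lemma few_positive_eigenvalues m M (W : 'M[R]_(m, n)) (a b : R) : M^T = M ->
    (count (fun t => 0 < a * t + b)%R (eigenvalues M) < m)%N ->
  exists2 x : 'rV[R]_m, x != 0 &
    a * qform M (x *m W) + b * qform 1%:M (x *m W) <= 0.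
Proof.
move=> symM cnt; have [U [d [UU MU Md]]] := spectral_toC symM.
have [||x x0 le0] := nonpositive_form W _ (spectral_affine a b UU MU).
- by rewrite linearD linearZ /= symM tr_scalar_mx.
- rewrite (eq_card (B := [pred i | 0 < a * d 0 i + b])).
    by rewrite (card_eigenvalues (fun t => 0 < a * t + b) Md).
  by move=> i; rewrite !inE !mxE.
exists x => //; move: le0.
by rewrite /qform mulmxDr mulmxDl mulmx1 mul_mx_scalar -scalemxAr -!scalemxAl !mxE.
Qed.

Lemma size_eigenvalues_sym M : M^T = M -> size (eigenvalues M) = n.
Proof.
move=> /spectral_toC[U [d [_ _ Md]]].
by rewrite (perm_size (perm_eigenvalues Md)) size_map size_enum_ord.
Qed.

(** One half of the Courant-Fischer theorem: fewer than [m] eigenvalues exceed the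
    [m]-th largest one. *)
Lemma rayleigh_le_lambda m M (W : 'M[R]_(m, n)) : M^T = M -> (0 < m <= n)%N ->
  exists2 x : 'rV[R]_m, x != 0 &
    qform M (x *m W) <= lambda m M * qform 1%:M (x *m W).
Proof.
move=> symM /andP[m0 mn]; set mu := lambda m M; set s := eigenvalues M.
have sz : size s = n := size_eigenvalues_sym symM.
have [|x x0 le0] := few_positive_eigenvalues W (a := 1) (b := - mu) symM.
  rewrite -/s -(cat_take_drop m.-1 s) count_cat [X in (_ + X)%N](_ : _ = 0%N).
    by rewrite addn0 (leq_ltn_trans (count_size _ _)) // size_take_min; lia.
  apply/eqP; rewrite -leqn0 leqNgt -has_count -all_predC.
  apply/(all_nthP 0) => i; rewrite size_drop sz nth_drop /= -leNgt mul1r subr_le0 => im.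
  by apply: sorted_ge_nth (sorted_eigenvalues M) _; rewrite -/s sz; lia.
by exists x => //; rewrite mul1r mulNr subr_le0 in le0.
Qed.

(** The other half, for the [m]-th smallest eigenvalue. *)
Lemma lambda_le_rayleigh m M (W : 'M[R]_(m, n)) : M^T = M -> (0 < m <= n)%N ->
  exists2 x : 'rV[R]_m, x != 0 &
    lambda (n.+1 - m) M * qform 1%:M (x *m W) <= qform M (x *m W).
Proof.
move=> symM /andP[m0 mn]; set mu := lambda _ M; set s := eigenvalues M.
have sz : size s = n := size_eigenvalues_sym symM.
have [|x x0 le0] := few_positive_eigenvalues W (a := -1) (b := mu) symM.
  rewrite -/s -(cat_take_drop (n.+1 - m) s) count_cat [X in (X + _)%N](_ : _ = 0%N).
    by rewrite add0n (leq_ltn_trans (count_size _ _)) // size_drop sz; lia.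
  apply/eqP; rewrite -leqn0 leqNgt -has_count -all_predC.
  apply/(all_nthP 0) => i; rewrite size_take_min => im.
  have {}im : (i < n.+1 - m)%N by lia.
  rewrite nth_take //= -leNgt mulN1r addrC subr_le0.
  by apply: sorted_ge_nth (sorted_eigenvalues M) _; rewrite -/s sz; lia.
by exists x => //; rewrite mulN1r addrC subr_le0 in le0.
Qed.

End RayleighBounds.

(** * Eigenvalues of [a D + b A] and edge cuts *)

Section LaplacianForm.
Variables (R : realType) (n : nat) (G : sgraph 'I_n).
Implicit Types (S T : {set 'I_n}) (al be a b : R).

Definition indicator S : 'rV[R]_n := \row_v (v \in S)%:R.

Lemma indicator_form (M : 'M[R]_n) S T :
  (indicator S *m M *m (indicator T)^T) 0 0 = \sum_(u in S) \sum_(v in T) M u v.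
Proof.
rewrite exchange_big /= mxE [RHS]big_mkcond /=; apply: eq_bigr => v _.
rewrite !mxE; case: (v \in T); last by rewrite mulr0.
rewrite mulr1 [RHS]big_mkcond /=; apply: eq_bigr => u _.
by rewrite mxE; case: (u \in S); rewrite ?mul1r ?mul0r.
Qed.

Lemma qform_indicators (M : 'M[R]_n) S T al be : M^T = M ->
  qform M (al *: indicator S + be *: indicator T) =
    al ^+ 2 * (\sum_(u in S) \sum_(v in S) M u v) +
    be ^+ 2 * (\sum_(u in T) \sum_(v in T) M u v) +
    2 * al * be * (\sum_(u in S) \sum_(v in T) M u v).
Proof.
move=> symM.
have TS : (indicator T *m M *m (indicator S)^T) 0 0 =
    (indicator S *m M *m (indicator T)^T) 0 0.
  rewrite !indicator_form exchange_big /=.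
  by apply: eq_bigr => u _; apply: eq_bigr => v _; rewrite -[in LHS]symM mxE.
rewrite -!indicator_form /qform linearD /= !linearZ /= mulmxDr !mulmxDl.
rewrite -!scalemxAr -!scalemxAl.
have addE (A B : 'M[R]_1) : (A + B) 0 0 = A 0 0 + B 0 0 by rewrite mxE.
have scaleE c (A : 'M[R]_1) : (c *: A) 0 0 = c * A 0 0 by rewrite mxE.
by rewrite !addE !scaleE TS; ring.
Qed.

Lemma sum_degree S :
  (\sum_(u in S) degree G u = cut G S S + cut G S (~: S))%N.
Proof.
rewrite /cut -big_split; apply: eq_bigr => u _ /=.
rewrite /degree -sum1_card big_mkcond [RHS](_ : _ = \sum_v adj G u v)%N; last first.
  rewrite [RHS](bigID [in S]) /=; congr (_ + _)%N.
  by apply: eq_bigl => v; rewrite inE.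
by apply: eq_bigr => v _; rewrite inE; case: adj.
Qed.

Lemma adjacency_indicators S T al be :
  qform (adjacency_mx R G) (al *: indicator S + be *: indicator T) =
    al ^+ 2 * (cut G S S)%:R + be ^+ 2 * (cut G T T)%:R
    + 2 * al * be * (cut G S T)%:R.
Proof.
have cutE (A B : {set 'I_n}) :
    \sum_(u in A) \sum_(v in B) adjacency_mx R G u v = (cut G A B)%:R.
  rewrite natr_sum; apply: eq_bigr => u _; rewrite natr_sum.
  by apply: eq_bigr => v _; rewrite mxE.
rewrite qform_indicators ?cutE //.
by apply/matrixP=> u v; rewrite !mxE adj_sym.
Qed.

Lemma diag_indicators (d : 'rV[R]_n) S T al be : [disjoint S & T] ->
  qform (diag_mx d) (al *: indicator S + be *: indicator T) =
    al ^+ 2 * (\sum_(u in S) d 0 u) + be ^+ 2 * (\sum_(u in T) d 0 u).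
Proof.
move=> dis.
have rowE u (B : {set 'I_n}) :
    \sum_(v in B) diag_mx d u v = if u \in B then d 0 u else 0.
  case: ifP => uB; last first.
    rewrite big1 // => v vB; rewrite mxE; case: eqP vB => // <-.
    by rewrite uB.
  rewrite (bigD1 u) //= mxE eqxx mulr1n big1 ?addr0 // => v /andP[_ vu].
  by rewrite mxE eq_sym (negPf vu).
have diagE (A : {set 'I_n}) :
    \sum_(u in A) \sum_(v in A) diag_mx d u v = \sum_(u in A) d 0 u.
  by apply: eq_bigr => u uA; rewrite rowE uA.
rewrite qform_indicators ?tr_diag_mx // !diagE.
rewrite [X in 2 * al * be * X]big1 ?mulr0 ?addr0 //.
by move=> u uS; rewrite rowE (disjointFr dis uS).
Qed.

Lemma qform_lin (M N : 'M[R]_n) a b f :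
  qform (a *: M + b *: N) f = a * qform M f + b * qform N f.
Proof. by rewrite /qform mulmxDr mulmxDl -!scalemxAr -!scalemxAl !mxE. Qed.

Lemma two_set_vector S T (x : 'rV[R]_(1 + 1)) : x != 0 -> exists al be,
  0 < al ^+ 2 + be ^+ 2 /\
  x *m col_mx (indicator S) (indicator T) =
    al *: indicator S + be *: indicator T.
Proof.
move=> x0; exists (lsubmx x 0 0), (rsubmx x 0 0); split; last first.
  rewrite -{1}(hsubmxK x) mul_row_col.
  by rewrite {1}[lsubmx x]mx11_scalar {1}[rsubmx x]mx11_scalar !mul_scalar_mx.
rewrite lt_def addr_ge0 ?sqr_ge0 // andbT paddr_eq0 ?sqr_ge0 // !sqrf_eq0.
apply: contra x0 => /andP[/eqP l0 /eqP r0]; rewrite -(hsubmxK x).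
by rewrite [lsubmx x]mx11_scalar [rsubmx x]mx11_scalar l0 r0 !raddf0 row_mx0.
Qed.

(** Let [f] be [al] on [S], [be] on [T] and [0] elsewhere, and let [L] be its Laplacian
    form, the sum of [(f u - f v) ^+ 2] over the edges [uv]. The form of [a D + b A] at
    [f] is [a + b] times the sum of [degree u * f u ^+ 2], minus [b * L]. By
    Courant-Fischer on the plane of these [f], the eigenvalue hypothesis provides
    [al] and [be], not both zero, with
    [2 * tau / (delta + 1) * (al ^+ 2 * #|S| + be ^+ 2 * #|T|) < L], where
    [tau = k + (delta - 1) / delta]; the degree sum is bounded below by means of
    [delta], and in the case [b < 0] its share [a D] above by means of [Delta].
    As [S] and [T] have more than [delta] vertices, [2 * tau * (al ^+ 2 + be ^+ 2) < L].
    On the other hand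
    [L = al ^+ 2 * cut S (~: S) + be ^+ 2 * cut T (~: T) - 2 * al * be * cut S T],
    at most [(al ^+ 2 + be ^+ 2) * (cut T (~: T) + cut S T)]. *)
Lemma spectral_separation (k delta Delta : nat) a b :
    (0 < delta)%N -> (forall v, (delta <= degree G v <= Delta)%N) -> 0 <= a ->
    (0 < b /\
       lambda_ab 2 G a b <
         (a + b) * delta%:R
         - 2 * b * (k%:R + (delta%:R - 1) / delta%:R) / (delta%:R + 1)
     \/ b < 0 /\
       lambda_ab (n - 1) G a b >
         a * Delta%:R + b * delta%:R
         - 2 * b * (k%:R + (delta%:R - 1) / delta%:R) / (delta%:R + 1)) ->
  separated G k delta.
Proof.
move=> d0 deg a0 cond S T dis dS dT le1.
have d0R : 0 < delta%:R :> R by rewrite ltr0n.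
set tau := k%:R + (delta%:R - 1) / delta%:R in cond.
have tauE : delta%:R * tau = (k.+1 * delta).-1%:R.
  rewrite /tau -subn1 natrB ?muln_gt0 // natrM -natr1; field.
  by rewrite gt_eqF.
have tau0 : 0 <= tau by rewrite -(pmulr_rge0 _ d0R) tauE.
set M := a *: degree_mx R G + b *: adjacency_mx R G.
have symM : M^T = M.
  rewrite linearD !linearZ /= tr_diag_mx; congr (_ + _ *: _).
  by apply/matrixP=> u v; rewrite !mxE adj_sym.
have n2 : (0 < 2 <= n)%N.
  by have := max_card S; rewrite card_ord; have := leq_trans (ltnW dS) ; lia.
pose L al be : R := al ^+ 2 * (cut G S (~: S))%:R + be ^+ 2 * (cut G T (~: T))%:R
  - 2 * al * be * (cut G S T)%:R.
pose q al be : R := al ^+ 2 * #|S|%:R + be ^+ 2 * #|T|%:R.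
pose v al be : R := al ^+ 2 * (\sum_(u in S) degree G u)%:R
  + be ^+ 2 * (\sum_(u in T) degree G u)%:R.
have q1E al be : qform 1%:M (al *: indicator S + be *: indicator T) = q al be.
  rewrite -diag_const_mx diag_indicators //.
  have sum1 (A : {set 'I_n}) : \sum_(u in A) (const_mx 1 : 'rV[R]_n) 0 u = #|A|%:R.
    by rewrite -sum1_card natr_sum; apply: eq_bigr => u _; rewrite mxE.
  by rewrite !sum1.
have qME al be : qform M (al *: indicator S + be *: indicator T) =
    (a + b) * v al be - b * L al be.
  rewrite qform_lin adjacency_indicators diag_indicators //.
  have sumd (A : {set 'I_n}) : \sum_(u in A) (\row_i (degree G i)%:R : 'rV[R]_n) 0 u
      = (\sum_(u in A) degree G u)%:R.
    by rewrite natr_sum; apply: eq_bigr => u _; rewrite mxE.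
  by rewrite !sumd /v /L !sum_degree !natrD; ring.
have vge al be : delta%:R * q al be <= v al be.
  rewrite /q /v mulrDr !(mulrCA delta%:R).
  by apply: lerD; apply: ler_wpM2l; rewrite ?sqr_ge0 // -natrM ler_nat
    mulnC -sum_nat_const; apply: leq_sum => u _; case/andP: (deg u).
have vle al be : v al be <= Delta%:R * q al be.
  rewrite /q /v mulrDr !(mulrCA Delta%:R).
  by apply: lerD; apply: ler_wpM2l; rewrite ?sqr_ge0 // -natrM ler_nat
    mulnC -sum_nat_const; apply: leq_sum => u _; case/andP: (deg u).
have qge al be : (delta%:R + 1) * (al ^+ 2 + be ^+ 2) <= q al be.
  rewrite /q mulrC mulrDl natr1.
  by apply: lerD; apply: ler_wpM2l; rewrite ?sqr_ge0 // ler_nat.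
have [al [be [ab0 ltL]]] : exists al be, 0 < al ^+ 2 + be ^+ 2 /\
    2 * tau / (delta%:R + 1) * q al be < L al be.
  pose W : 'M[R]_(1 + 1, n) := col_mx (indicator S) (indicator T).
  pose c := 2 * tau / (delta%:R + 1).
  have cE : 2 * b * tau / (delta%:R + 1) = b * c by rewrite /c; ring.
  have qpos al be : 0 < al ^+ 2 + be ^+ 2 -> 0 < q al be.
    by move=> h; apply: lt_le_trans (qge al be); rewrite mulr_gt0 // addr_gt0.
  rewrite cE in cond; case: cond => [[b0 lt_lam]|[b0 lt_lam]].
    have [x x0 le] := rayleigh_le_lambda W symM n2.
    have [al [be [ab0 xW]]] := two_set_vector S T x0.
    exists al, be; split=> //; rewrite -/c -(ltr_pM2l b0).
    rewrite xW q1E qME in le.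
    rewrite -(ltr_pM2r (qpos _ _ ab0)) in lt_lam; move: lt_lam.
    have := ler_wpM2l (addr_ge0 a0 (ltW b0)) (vge al be).
    move: le; rewrite /lambda_ab -/M.
    clear cE.
    by move: (lambda 2 M) (v al be) (q al be) (L al be) c => lam v' q' L' c'; lra.
  have [x x0 le] := lambda_le_rayleigh W symM n2.
  have [al [be [ab0 xW]]] := two_set_vector S T x0.
  exists al, be; split=> //; rewrite -/c -(ltr_nM2l b0).
  rewrite xW q1E qME subSS in le.
  rewrite -(ltr_pM2r (qpos _ _ ab0)) in lt_lam; move: lt_lam.
  have := ler_wnM2l (ltW b0) (vge al be); have := ler_wpM2l a0 (vle al be).
  move: le; rewrite /lambda_ab -/M.
  clear cE.
  move: (lambda (n - 1) M) (v al be) (q al be) (L al be) c => lam v' q' L' c'.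
  lra.
rewrite leqNgt -(ltr_nat R) !natrM natrD -tauE [2 * _]mulrCA; apply/negP.
rewrite ltr_pM2l // => lt_tau.
have le_L : L al be <= (al ^+ 2 + be ^+ 2) * ((cut G T (~: T))%:R + (cut G S T)%:R).
  have le1R : (cut G S (~: S))%:R <= (cut G T (~: T))%:R :> R by rewrite ler_nat.
  have := ler_wpM2l (sqr_ge0 al) le1R.
  have := mulr_ge0 (sqr_ge0 (al + be)) (ler0n R (cut G S T)).
  rewrite /L; lra.
have le_q : 2 * tau * (al ^+ 2 + be ^+ 2) <= 2 * tau / (delta%:R + 1) * q al be.
  rewrite -[leRHS]mulrA ler_wpM2l ?mulr_ge0 //.
  by rewrite mulrC ler_pdivlMr ?addr_gt0 // mulrC.
have := lt_le_trans ltL le_L; rewrite -(ltr_pM2l ab0) in lt_tau.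
lra.
Qed.

End LaplacianForm.

(** * The theorem *)

Lemma min_degree_le (V : finType) (G : sgraph V) v : (min_degree G <= degree G v)%N.
Proof.
rewrite /min_degree; have : v \in index_enum V := mem_index_enum v.
elim: (index_enum V) => [|w s IHs] //; rewrite in_cons big_cons => /predU1P[->|/IHs].
  exact: geq_minl.
exact: leq_trans (geq_minr _ _).
Qed.

Theorem corollary5p2 (R : realType) (k n : nat) (G : sgraph 'I_n)
    (delta Delta : nat) (a b : R)
    (hk : (0 < k)%N)
    (hdelta : min_degree G = delta) (hDelta : max_degree G = Delta)
    (hdelta_k : (2 * k + 2 <= delta)%N)
    (ha : 0 <= a) (hb : b != 0)
    (hcond :
      [\/ lambda_a 2 G a <
            (a + 1) * delta%:R
            - 2 * (k%:R + (delta%:R - 1) / delta%:R) / (delta%:R + 1),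
          0 < b /\
          lambda_ab 2 G a b <
            (a + b) * delta%:R
            - 2 * b * (k%:R + (delta%:R - 1) / delta%:R) / (delta%:R + 1)
        | b < 0 /\
          lambda_ab (n - 1) G a b >
            a * Delta%:R + b * delta%:R
            - 2 * b * (k%:R + (delta%:R - 1) / delta%:R) / (delta%:R + 1)]) :
  property_P G k delta.
Proof.
have deg v : (delta <= degree G v <= Delta)%N.
  by rewrite -hdelta -hDelta min_degree_le leq_bigmax.
have n_gt0 : (0 < #|'I_n|)%N.
  rewrite lt0n; apply: contraTneq hdelta_k => n0.
  suff -> : delta = 0%N by rewrite addn2.
  by rewrite -hdelta /min_degree big_pred0 // => v; case: (fintype0 v n0).
have delta_gt0 : (0 < delta)%N by lia.
apply: separation_property_P => // [v|]; first by case/andP: (deg v).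
case: hcond => [cond|cond|cond].
(* The first condition is the second one for b = 1. *)
- apply: (spectral_separation (a := a) (b := 1) delta_gt0 deg ha); left; split=> //.
  by move: cond; rewrite mulr1 /lambda_ab scale1r.
- by apply: (spectral_separation delta_gt0 deg ha); left; exact: cond.
- by apply: (spectral_separation delta_gt0 deg ha); right; exact: cond.
Qed.
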